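(* There is an absolute constant $C>0$ such that for every integer $n\ge 3$ and every set $B$ of $n$ natural numbers, every arithmetic progression (with nonzero common difference) contained in the product set $B.B=\{bb' : b,b'\in B\}$ has length at most $C\,\frac{n\log^2 n}{\log\log n}$.
   Context: The length of an arithmetic progression is its number of terms. *)

(* Defs.v *)
From mathcomp Require Import all_boot all_order all_algebra finmap.
From mathcomp Require Import all_classical all_reals all_analysis.

Set Implicit Arguments.
Unset Strict Implicit.
Unset Printing Implicit Defensive.

Import Order.TTheory GRing.Theory Num.Theory.
Local Open Scope fset_scope.
Local Open Scope ring_scope.

Definition product_set (B : {fset nat}) : {fset nat} :=
  [fset (b * b')%N | b in B, b' in B].

(* The terms are natural numbers, but the common difference [d] is a nonzero
   integer, so decreasing progressions are included.  The number of terms of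
   the progression is [size s]. *)
Definition arith_progression (s : seq nat) : Prop :=
  exists a d : int,
    d != 0 /\ [seq x%:Z | x <- s] = [seq a + i%:Z * d | i <- iota 0 (size s)].

(* Main.v *)
Require Import Defs.
From mathcomp Require Import all_boot all_order all_algebra finmap.
From mathcomp Require Import all_classical all_reals all_analysis.
From mathcomp Require Import zify ring lra.

(** Write the progression as [g (a + j d)] with [a], [d] coprime and keep the
    [2 ^ L] terms with [2 ^ (L + 12) <= j < 2 ^ (L + 12) + 2 ^ L]; they are a
    fixed proportion of the progression.

    - If [a + j d] has a prime factor [p > 2 ^ L], then [p] divides no other kept
      [a + i d].  Attach to each such term [b c] the vector [e_b + e_c] of
      [rat^B]; the [p]-adic valuations show that these vectors are independent,
      so there are at most [n] such terms.
    - For every prime [p <= 2 ^ L] discard a term of maximal [p]-adic valuation.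
      As in Erdos's proof of the Sylvester theorem, the product of the remaining
      terms without prime factor above [2 ^ L] divides [(2 ^ L)!]; each of them
      being at least [2 ^ (L + 12)], they are at most [L 2 ^ L / (L + 12)].

    With Chebyshev's bound [4 2 ^ L / L] on the number of discarded terms, this
    gives [2 ^ (L + 1) <= L n], so the length of the progression is
    [O(n log n)], which is stronger than the theorem. *)

Set Implicit Arguments.
Unset Strict Implicit.
Unset Printing Implicit Defensive.

Import Order.TTheory GRing.Theory Num.Theory.

(** * Chebyshev's upper bound for the number of primes *)

Lemma prod_primes_dvdn (s : seq nat) (m : nat) :
  uniq s -> {in s, forall p, prime p && (p %| m)} -> \prod_(p <- s) p %| m.
Proof.
elim: s => [|p s IHs] /=; first by rewrite big_nil dvd1n.
case/andP=> ps us sP; have /andP[p_pr pm] := sP p (mem_head p s).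
have IH : \prod_(q <- s) q %| m.
  by apply: IHs => // q qs; apply: sP; rewrite inE qs orbT.
rewrite big_cons Gauss_dvd ?pm // prime_coprime // Euclid_dvd_prod // big_has.
apply/hasPn => q qs.
have /andP[q_pr _] : prime q && (q %| m) by apply: sP; rewrite inE qs orbT.
by rewrite dvdn_prime2 //; apply: contraNneq ps => ->.
Qed.

Lemma dvdn_prime_fact (p m : nat) : prime p -> (p %| m`!) = (p <= m).
Proof.
move=> p_pr; elim: m => [|m IHm].
  by rewrite dvdn1; case: p p_pr => [|[|]].
rewrite factS Euclid_dvdM // IHm; apply/orP/idP => [[/dvdn_leq->//|/leqW//]|].
by rewrite leq_eqVlt ltnS => /orP[/eqP->|->]; [left | right].
Qed.

Lemma bin_double_leq (m : nat) : 'C(m.*2, m) <= 2 ^ m.*2.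
Proof.
have mle : m < m.*2.+1 by rewrite ltnS -addnn leq_addr.
have -> : 2 ^ m.*2 = \sum_(i < m.*2.+1) 'C(m.*2, i).
  rewrite -[2]/(1 + 1)%N expnDn; apply: eq_bigr => i _.
  by rewrite !exp1n !muln1.
by rewrite (bigD1 (Ordinal mle)) //= leq_addr.
Qed.

Definition primepi (m : nat) : nat := #|[set p : 'I_m.+1 | prime p]|.

Lemma primepiE (m : nat) : primepi m = count prime (iota 0 m.+1).
Proof.
rewrite /primepi cardsE cardE size_filter -enumT.
by rewrite -val_enum_ord count_map.
Qed.

(** Every prime in [(m, 2 m]] divides the binomial coefficient ['C(m.*2, m)], hence so does their
    product. *)
Lemma primepi_double (m : nat) :
  m ^ (primepi m.*2 - primepi m) <= 2 ^ m.*2.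
Proof.
rewrite !primepiE -addnn -addSn iotaD count_cat addKn add0n -size_filter.
set s := [seq _ <- _ | _].
have us : uniq s by rewrite filter_uniq ?iota_uniq.
have sP p : p \in s -> [&& prime p, m < p & p <= m + m].
  by rewrite mem_filter mem_iota addSn ltnS.
have := bin_double_leq m; rewrite -addnn; apply: leq_trans.
have bin0 : 0 < 'C(m + m, m) by rewrite bin_gt0 leq_addr.
apply: (@leq_trans (\prod_(p <- s) p)).
  have {}sP : {in s, forall p, m <= p} by move=> p /sP /and3P[_ /ltnW].
  elim: s {us} sP => [|p s IHs] sP; first by rewrite big_nil.
  rewrite big_cons expnS leq_mul //; first by apply: sP; rewrite mem_head.
  by apply: IHs => q qs; apply: sP; rewrite inE qs orbT.
apply: dvdn_leq => //; apply: prod_primes_dvdn => // p /sP/and3P[p_pr mp pm].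
rewrite p_pr /=; have := dvdn_prime_fact (m + m) p_pr.
rewrite pm -(bin_fact (leq_addr m m)) addKn !Euclid_dvdM // !dvdn_prime_fact //.
by rewrite leqNgt mp !orbF.
Qed.

Lemma primepi_pow2 (L : nat) : L * primepi (2 ^ L) <= 4 * 2 ^ L.
Proof.
elim: L => [//|L IHL].
(* The bound at [L] and the doubling give [L * primepi (2 ^ L.+1) <= 6 * 2 ^ L], which closes the
   induction once [6 * L.+1 <= 8 * L], that is [3 <= L]. *)
have [L2|] := leqP 3 L; last first.
  case: L {IHL} => [|[|[|//]]] _; rewrite primepiE //.
have := primepi_double (2 ^ L).
have -> : (2 ^ L).*2 = 2 ^ L.+1 by rewrite expnS mul2n.
rewrite -expnM leq_exp2l // expnS.
move: (primepi (2 * 2 ^ L)) (primepi (2 ^ L)) (2 ^ L) IHL => x y z; nia.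
Qed.

(** * Valuations along a progression and the count of smooth terms *)

(* [(i - j) + (j - i)] is the distance between [i] and [j], as one of the two
   truncated differences vanishes. *)
Lemma logn_ap_leq_dist (p a d i j : nat) :
    prime p -> coprime a d -> 0 < a -> i != j ->
    logn p (a + i * d) <= logn p (a + j * d) ->
  logn p (a + i * d) <= logn p ((i - j) + (j - i)).
Proof.
move=> p_pr cop_ad a0 neq_ij le_ij.
have [pd|npd] := boolP (p %| d).
  rewrite lognE p_pr addn_gt0 a0 dvdn_addl ?dvdn_mull //.
  case: ifP => // /and3P[_ _ pa]; have : p %| gcdn a d by rewrite dvdn_gcd pa.
  by rewrite (eqP cop_ad) dvdn1 => /eqP p1; rewrite p1 in p_pr.
set v := logn p (a + i * d) in le_ij *.
have pi : p ^ v %| a + i * d by rewrite pfactor_dvdn // addn_gt0 a0.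
have pj : p ^ v %| a + j * d by rewrite pfactor_dvdn // addn_gt0 a0.
have cop_vd : coprime (p ^ v) d by rewrite coprimeXl // prime_coprime.
rewrite -pfactor_dvdn //; last by lia.
rewrite -(Gauss_dvdl _ cop_vd) mulnDl.
apply: dvdn_add; rewrite mulnBl -(subnDl a); exact: dvdn_sub.
Qed.

Lemma prod_dist (N r : nat) : r < N ->
  \prod_(0 <= j < N | j != r) ((j - r) + (r - j)) = r`! * (N.-1 - r)`!.
Proof.
move=> rN; rewrite (@big_cat_nat _ _ _ r) //=; last exact: ltnW.
congr (_ * _).
  rewrite fact_prod big_add1 /= big_nat_rev /= big_nat_cond [RHS]big_nat_cond.
  by apply: eq_big => [j | j]; lia.
rewrite big_ltn_cond // eqxx /= fact_prod.
rewrite -[r.+1]add1n addnC -[in LHS](subnK (ltnW rN)) [r + 1]addnC big_addn.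
rewrite addnK.
have -> : (N.-1 - r).+1 = N - r by lia.
rewrite big_nat_cond [RHS]big_nat_cond.
by apply: eq_big => [j | j]; lia.
Qed.

Lemma logn_prod (p : nat) (I : Type) (s : seq I) (P : pred I) (F : I -> nat) :
    (forall i, P i -> 0 < F i) ->
  logn p (\prod_(i <- s | P i) F i) = \sum_(i <- s | P i) logn p (F i).
Proof.
move=> F0; apply: proj2 (_ : 0 < \prod_(i <- s | P i) F i /\ _).
elim/big_rec2: _ => [|i x y Pi [y0 <-]]; first by rewrite logn1.
by rewrite muln_gt0 y0 F0 // lognM ?F0.
Qed.

(** The product of the distances from [r] divides the factorial of [N.-1], with a binomial
    coefficient as quotient. *)
Lemma sum_logn_dist (p N : nat) (r : 'I_N) : 
  \sum_(j < N | j != r) logn p ((j - r) + (r - j)) <= logn p N`!.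
Proof.
have rN := ltn_ord r.
rewrite -logn_prod => [|j]; last by rewrite -val_eqE /=; lia.
have -> : \prod_(j < N | j != r) (j - r + (r - j)) = r`! * (N.-1 - r)`!.
  by rewrite -prod_dist // big_mkord.
apply: dvdn_leq_log; first exact: fact_gt0.
have rN1 : r <= N.-1 by lia.
apply: (@dvdn_trans N.-1`!); first by rewrite -(bin_fact rN1) dvdn_mull.
by rewrite -(prednK (leq_ltn_trans (leq0n r) rN)) /= factS dvdn_mull.
Qed.

(* For each prime [p <= N] discard a term of maximal [p]-adic valuation: the
   valuation of any other term is bounded by that of its distance to it. *)
Lemma prod_smooth_ap_dvdn_fact (N a d : nat) : coprime a d -> 0 < a ->
  exists2 D : {set 'I_N}, #|D| <= primepi N &
    \prod_(j < N | (j \notin D) && all (geq N) (primes (a + j * d)))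
      (a + j * d) %| N`!.
Proof.
move=> cop_ad a0; case: N => [|N].
  by exists finset.set0; rewrite ?cards0 // big_ord0.
pose r (p : nat) := [arg max_(j > (ord0 : 'I_N.+1)) logn p (a + j * d)].
exists [set r (val p) | p in [set p : 'I_N.+2 | prime p]].
  exact: leq_imset_card.
set D := [set _ | _ in _].
have u0 j : 0 < a + j * d by rewrite addn_gt0 a0.
apply/dvdn_partP => [|p pin]; first by apply: prodn_gt0.
have p_pr : prime p.
  by move: pin; rewrite mem_primes => /andP[].
rewrite p_part pfactor_dvdn ?fact_gt0 // logn_prod => [|j _]; last exact: u0.
have [pN|Np] := leqP p N.+1; last first.
  rewrite big1 // => j /andP[_ /allP smooth]; apply/eqP.
  rewrite -leqn0 leqNgt logn_gt0; apply/negP => /smooth /=.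
  by rewrite leqNgt Np.
have rD : r p \in D.
  have pN2 : p < N.+2 by [].
  by apply/imsetP; exists (Ordinal pN2); rewrite ?inE.
have rmax (j : 'I_N.+1) : logn p (a + j * d) <= logn p (a + r p * d).
  by rewrite /r; case: arg_maxnP => // i _; apply.
apply: leq_trans (sum_logn_dist p (r p)).
rewrite [leqRHS]big_mkcond [leqLHS]big_mkcond /=; apply: leq_sum => j _.
case: ifP => // /andP[jD _].
have jr : j != r p by apply: contraNneq jD => ->.
by rewrite jr; apply: logn_ap_leq_dist.
Qed.

(** The smooth terms that are not discarded are at least [2 ^ (L + k)] each, and their product is at
    most [N ^ N = 2 ^ (L * N)], so there are at most [L * N / (L + k)] of them. *)
Lemma card_rough_ap (L k a d : nat) : coprime a d -> 2 ^ (L + k) <= a ->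
  k * 2 ^ L <= (L + k) * (primepi (2 ^ L)
    + #|[set j : 'I_(2 ^ L) | ~~ all (geq (2 ^ L)) (primes (a + j * d))]|).
Proof.
move=> cop_ad aL; have a0 : 0 < a by apply: leq_trans aL; rewrite expn_gt0.
set N := 2 ^ L; set M := [set j | _].
have [D cardD] := @prod_smooth_ap_dvdn_fact N a d cop_ad a0.
move/(dvdn_leq (fact_gt0 N)) => prodN.
have prod_ge : 2 ^ ((L + k) * #|~: (D :|: M)|) <= 2 ^ (L * N).
  apply: (@leq_trans N`!); last first.
    (* Induction shows that the factorial of [i] is at most [m ^ i] whenever [i <= m]. *)
    rewrite expnM -/N; elim: (N) {2 4}(N) (leqnn N) => [|i IHi] m im.
      by rewrite expn0.
    by rewrite factS expnS leq_mul // IHi // ltnW.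
  apply: leq_trans prodN; rewrite expnM -prod_nat_const.
  rewrite [leqRHS](eq_bigl (mem (~: (D :|: M)))) => [|j]; last first.
    by rewrite !inE negb_or negbK.
  by apply: leq_prod => j _; apply: leq_trans aL _; apply: leq_addr.
rewrite leq_exp2l // in prod_ge.
have := cardsC (D :|: M); rewrite card_ord.
have [cardU _] := leq_card_setU D M => cardC.
have : N <= #|~: (D :|: M)| + (primepi N + #|M|).
  rewrite -{1}cardC addnC leq_add2l (leq_trans cardU) //.
  by rewrite leq_add2r.
move/(leq_mul (leqnn (L + k))).
rewrite mulnDr [(L + k) * N]mulnDl => h.
rewrite -(leq_add2l (L * N)); apply: leq_trans h _.
by rewrite leq_add2r.
Qed.

(** * Linear independence and terms with a large prime factor *)

(** The product is diagonal with nonzero diagonal, hence of rank [m], and it factors through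
    dimension [n]. *)
Lemma mxrank_factor_diag (F : fieldType) (m n : nat)
    (X : 'M[F]_(m, n)) (Y : 'M[F]_(n, m)) :
    (forall i j, ((X *m Y) i j == 0) = (i != j))%R ->
  m <= n.
Proof.
move=> XY; suff XYu : (X *m Y)%R \in unitmx.
  by rewrite -(mxrank_unit XYu) mulmx_max_rank.
have XYd : (X *m Y = diag_mx (\row_i (X *m Y) i i))%R.
  move: (X *m Y)%R XY => Z XY; apply/matrixP => i j; rewrite !mxE.
  have := XY i j; case: (eqVneq i j) => [<- _|_ /eqP Zij].
    by rewrite mulr1n.
  by rewrite mulr0n.
rewrite XYd unitmxE det_diag unitfE; apply/prodf_neq0 => i _.
by rewrite mxE XY eqxx.
Qed.

Lemma sum_nth_eq (R : pzRingType) (B : seq nat) (b : nat) (f : nat -> R) :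
  uniq B -> b \in B ->
  (\sum_(k < size B) (nth 0%N B k == b)%:R * f (nth 0%N B k) = f b)%R.
Proof.
move=> uB bB.
rewrite -(big_mkord xpredT
  (fun k => (nth 0%N B k == b)%:R * f (nth 0%N B k))%R) -(big_nth 0%N xpredT
  (fun x => (x == b)%:R * f x)%R).
rewrite (big_rem b) //= eqxx mul1r big_seq big1 ?addr0 // => x.
rewrite mem_rem_uniq // inE => /andP[/= /negPf-> _].
by rewrite mul0r.
Qed.

(* The vectors [e_(b i) + e_(c i)] of [rat^B], [i \in M], are independent: the
   functional sending [e_x] to [logn (q i) x - logn (q i) g / 2] takes the value
   [logn (q i) (u j)] on the [j]-th one, which vanishes exactly when [j != i]. *)
Lemma card_private_primes (I : finType) (M : {set I}) (B : seq nat) (g : nat)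
    (u b c q : I -> nat) :
    uniq B -> 0 < g ->
    {in M, forall i, [/\ b i \in B, c i \in B & b i * c i = g * u i]} ->
    {in M, forall i, prime (q i) /\ 0 < u i} ->
    {in M &, forall i j, (q i %| u j) = (i == j)} ->
  #|M| <= size B.
Proof.
move=> uB g0 bcP qP quP.
pose e := @enum_val I (mem M).
have eM i : e i \in M by apply: enum_valP.
pose X := (\matrix_(i < #|M|, k < size B)
  ((nth 0%N B k == b (e i))%:R + (nth 0%N B k == c (e i))%:R) : 'M[rat]_(_, _))%R.
pose f (j : 'I_#|M|) (x : nat) : rat :=
  ((logn (q (e j)) x)%:R - (logn (q (e j)) g)%:R / 2%:R)%R.
pose Y := (\matrix_(k < size B, j < #|M|) f j (nth 0%N B k))%R.
apply: (@mxrank_factor_diag _ _ _ X Y) => i j.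
have -> : ((X *m Y) i j = (logn (q (e j)) (u (e i)))%:R)%R.
  rewrite mxE.
  under eq_bigr => k _ do rewrite !mxE mulrDl.
  have [bB cB bc] := bcP _ (eM i).
  have [_ u0] := qP _ (eM i).
  rewrite big_split /= !sum_nth_eq // /f.
  have := congr1 (logn (q (e j))) bc.
  have bc0 : 0 < b (e i) * c (e i) by rewrite bc muln_gt0 g0.
  move: (bc0); rewrite muln_gt0 => /andP[b0 c0].
  rewrite !lognM // => /(congr1 (fun n : nat => n%:R : rat)%R); rewrite !natrD.
  move=> E; transitivity ((logn (q (e j)) (b (e i)))%:R
    + (logn (q (e j)) (c (e i)))%:R - (logn (q (e j)) g)%:R : rat)%R.
    by field.
  by rewrite E; ring.
have [q_pr _] := qP _ (eM j); have [_ u0] := qP _ (eM i).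
rewrite pnatr_eq0 eqn0Ngt logn_gt0 mem_primes q_pr u0 quP //.
by rewrite (inj_eq enum_val_inj) eq_sym.
Qed.

(** * The bound for progressions of length a power of two *)

Local Open Scope fset_scope.
Local Open Scope ring_scope.

Lemma pow2_le_card_ap_factors (B : seq nat) (a d L : nat) :
    uniq B -> (0 < d)%N -> (12 <= L)%N ->
    (forall i, (i < 2 ^ (L + 13))%N ->
       exists bc : nat * nat,
         [/\ bc.1 \in B, bc.2 \in B & (bc.1 * bc.2 = a + i * d)%N]) ->
  (2 ^ L.+1 <= L * size B)%N.
Proof.
move=> uB d0 L12 apB.
pose g := gcdn a d; have g0 : (0 < g)%N by rewrite gcdn_gt0 d0 orbT.
(* The shift by [2 ^ (L + 12)] terms makes every kept term large, even if [a = 0]. *)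
pose d' := (d %/ g)%N; pose a' := (a %/ g + 2 ^ (L + 12) * d')%N.
have dE : (d = g * d')%N by rewrite mulnC divnK ?dvdn_gcdr.
have aE : (a = g * (a %/ g))%N by rewrite mulnC divnK ?dvdn_gcdl.
have d'0 : (0 < d')%N by move: d0; rewrite dE muln_gt0 => /andP[].
have cop : coprime a' d'.
  rewrite /a' /coprime gcdnC addnC gcdnMDl gcdnC.
  rewrite -(eqn_pmul2l g0) muln1 muln_gcdr -aE -dE; exact: eqxx.
have a'L : (2 ^ (L + 12) <= a')%N.
  by apply: leq_trans (leq_addl _ _); rewrite leq_pmulr.
have a'0 : (0 < a')%N by apply: leq_trans a'L; rewrite expn_gt0.
set N := (2 ^ L)%N.
pose u (j : 'I_N) := (a' + j * d')%N.
have u0 j : (0 < u j)%N by rewrite addn_gt0 a'0.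
have /fin_all_exists[bc bcP] (j : 'I_N) : exists bc : nat * nat,
    [/\ bc.1 \in B, bc.2 \in B & (bc.1 * bc.2 = g * u j)%N].
  have jL : (2 ^ (L + 12) + j < 2 ^ (L + 13))%N.
    have jN : (j < 2 ^ L)%N := ltn_ord j.
    rewrite [(L + 13)%N]addnS [(2 ^ _.+1)%N]expnS mul2n -addnn ltn_add2l.
    rewrite (leq_trans jN) //.
    by rewrite leq_exp2l // leq_addr.
  have [bc [bB cB bcE]] := apB _ jL; exists bc; split=> //.
  by rewrite bcE /u /a' {1}aE {1}dE; ring.
have := @card_rough_ap L 12 a' d' cop a'L; rewrite -/N; set M := [set j | _].
have cardM : (#|M| <= size B)%N.
  (* For [j] in [M] the term [u j] has a prime factor above [N], so the default [0] is not
     reached. *)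
  pose q j := head 0%N [seq p <- primes (u j) | (N < p)%N].
  have qP j : j \in M -> [/\ (N < q j)%N, prime (q j) & q j %| u j]%N.
    rewrite inE -has_predC has_filter /q.
    rewrite (@eq_filter _ _ (fun p => N < p)%N); last first.
      by move=> p /=; rewrite -ltnNge.
    rewrite -/(u j).
    have : {subset [seq p <- primes (u j) | (N < p)%N] <=
        [pred p | [&& N < p, prime p & p %| u j]%N]}.
      move=> p; rewrite mem_filter mem_primes inE.
      by case/and4P=> [-> -> _ ->].
    case: [seq _ <- _ | _] => //= p s /(_ p (mem_head _ _)).
    by rewrite inE => /and3P[].
  apply: (@card_private_primes _ M B g u (fst \o bc) (snd \o bc) q) => //.
  - by move=> j _; apply: bcP.
  - by move=> j /qP[].
  move=> i j iM jM; have [qN q_pr qu] := qP i iM.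
  (* A prime dividing both terms is coprime to [d'], so it divides the distance from [i] to [j],
     which is below [N < q i]. *)
  case: eqVneq => [<-//|ij]; apply/negP => quj.
  have qd : coprime (q i) d'.
    rewrite prime_coprime //; apply/negP => qd.
    have : (q i %| gcdn a' d')%N.
      by rewrite dvdn_gcd qd andbT -(dvdn_addl _ (dvdn_mull i qd)).
    by rewrite (eqP cop) dvdn1 => /eqP q1; rewrite q1 in q_pr.
  have : (q i %| (i - j) + (j - i))%N.
    rewrite -(Gauss_dvdl _ qd) mulnDl.
    by apply: dvdn_add; rewrite mulnBl -(subnDl a'); apply: dvdn_sub.
  have iN := ltn_ord i; have jN := ltn_ord j.
  have {}ij : (i != j :> nat)%N by [].
  move/dvdn_leq; lia.
(* Since [L + 12 <= 2 * L], the primes account for at most [8 * N] of the [12 * N]; the remaining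
   [4 * N] is at most [2 * L * size B]. *)
have := primepi_pow2 L; rewrite -/N expnS -/N.
move: (primepi N) (#|M|) cardM => x y; nia.
Qed.

(** * Reduction to positive differences and passage to logarithms *)

Lemma arith_progression_nat (s : seq nat) : arith_progression s ->
  exists a d : nat, (0 < d)%N /\
    forall i, (i < size s)%N -> (a + i * d)%N \in s.
Proof.
case=> a [d [d0 sE]].
have sP i : (i < size s)%N -> (nth 0%N s i)%:Z = a + i%:Z * d.
  move=> iN; rewrite -(nth_map _ 0 (fun x : nat => x%:Z)) // sE.
  by rewrite (nth_map 0%N) ?size_iota // nth_iota.
have [s0|s0] := posnP (size s).
  by exists 0%N, 1%N; split=> // i; rewrite s0.
have [dpos|dneg] := ltP 0 d.
  exists (nth 0%N s 0), `|d|%N; split=> [|i iN]; first by lia.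
  have -> : (nth 0%N s 0 + i * `|d| = nth 0%N s i)%N.
    by have := sP _ iN; have := sP _ s0; nia.
  exact: mem_nth.
(* A decreasing progression is read backwards from its last term. *)
exists (nth 0%N s (size s).-1), `|d|%N; split=> [|i iN]; first by lia.
have lt1 : ((size s).-1 - i < size s)%N by lia.
have -> : (nth 0%N s (size s).-1 + i * `|d| = nth 0%N s ((size s).-1 - i))%N.
  have lt2 : ((size s).-1 < size s)%N by lia.
  have := sP _ lt1; have := sP _ lt2; nia.
exact: mem_nth.
Qed.

(** From [ln (5 / 6) <= - 1 / 6] follows [1 <= ln ((6 / 5) ^ 6)], and [(6 / 5) ^ 6 < 3]. This makes
    [ln (ln n)] positive for [n >= 3]. *)
Lemma ln3_gt1 (R : realType) : 1 < ln (3%:R : R).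
Proof.
have h : 1 / 6%:R <= ln (6%:R / 5%:R : R).
  have := @le_ln1Dx R (- (1 / 6%:R)).
  have -> : 1 + - (1 / 6%:R) = (6%:R / 5%:R)^-1 :> R by field.
  rewrite lnV ?posrE; last by lra.
  lra.
have h6 : 1 <= ln ((6%:R / 5%:R : R) ^+ 6).
  rewrite lnXn; last by lra.
  rewrite -[leRHS]mulr_natl; lra.
apply: le_lt_trans h6 _; rewrite ltr_ln ?posrE; lra.
Qed.

(** As [L ^ 2 <= 2 ^ L], squaring the last hypothesis gives [2 ^ L <= n ^ 2], so [L] is at most
    [2 * ln n / ln 2], while [N <= 2 ^ 13 * (L * n)]. *)
Lemma ap_length_le_nlogn (R : realType) (N n L : nat) :
    (4 <= L)%N -> (3 <= n)%N -> (N <= 2 ^ (L + 14))%N ->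
    (2 ^ L.+1 <= L * n)%N ->
  N%:R <= 2 ^+ 14 / ln 2 * (n%:R * ln n%:R) :> R.
Proof.
move=> L4 n3 NL Ln.
have ln2 : 0 < ln (2 : R) by apply: ln_gt0; lra.
have L2 : (L ^ 2 <= 2 ^ L)%N.
  elim: L L4 {NL Ln} => // L IHL; rewrite leq_eqVlt => /orP[/eqP <-//|].
  rewrite ltnS => L4; have := IHL L4; rewrite [(2 ^ L.+1)%N]expnS -!mulnn; nia.
have Ln2 : (2 ^ L <= n ^ 2)%N.
  have x0 : (0 < 2 ^ L)%N by rewrite expn_gt0.
  have := leq_mul Ln Ln; rewrite [leqRHS]mulnn expnMn => Ln2.
  rewrite -(leq_pmul2l x0); apply: leq_trans (_ : L ^ 2 * n ^ 2 <= _)%N.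
    by apply: leq_trans Ln2; rewrite expnS leq_mul // leq_pmull.
  by rewrite leq_mul2r L2 orbT.
have lnL : L%:R * ln (2 : R) <= 2 * ln (n%:R : R).
  have n0 : 0 < n%:R :> R by rewrite ltr0n; lia.
  rewrite !mulr_natl -!lnXn // ler_ln ?posrE ?exprn_gt0 //.
  by rewrite -!natrX ler_nat.
have NLn : (N <= 2 ^ 13 * (L * n))%N.
  apply: leq_trans NL _.
  by rewrite addnC -[14%N]/(13 + 1)%N -addnA add1n expnD leq_mul2l Ln orbT.
apply: (@le_trans _ _ (2 ^ 13 * (L * n))%:R); first by rewrite ler_nat.
rewrite natrM natrX natrM [leRHS]mulrAC ler_pdivlMr //.
have n0 : 0 <= n%:R :> R by rewrite ler0n.
have := ler_wpM2l n0 lnL.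
move: (L%:R : R) (ln (2 : R)) {lnL ln2 n0} => x y h.
have -> : 2 ^+ 13 * (x * n%:R) * y = 2 ^+ 13 * (n%:R * (x * y)) by ring.
have -> : 2 ^+ 14 * (n%:R * ln n%:R) = 2 ^+ 13 * (n%:R * (2 * ln n%:R)) :> R.
  by rewrite [2 ^+ 14]exprS; ring.
by rewrite ler_pM2l ?exprn_gt0.
Qed.

Theorem theorem1 (R : realType) :
  exists C : R, 0 < C /\
    forall (n : nat) (B : {fset nat}), (3 <= n)%N -> #|` B| = n ->
      forall s : seq nat, arith_progression s -> {subset s <= product_set B} ->
        (size s)%:R <= C * (n%:R * ln n%:R ^+ 2 / ln (ln n%:R)).
Proof.
have ln2 : 0 < ln (2 : R) by apply: ln_gt0; lra.
(* Naming the exponent keeps the unary numeral [2 ^ 25] from being computed. *)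
have [K KE] : exists K, K = 25%N by exists 25%N.
exists (2 ^+ K / ln 2); split; first by rewrite divr_gt0 ?exprn_gt0.
move=> n B n3 cardB s sap sB.
have lnn : 1 < ln (n%:R : R).
  apply: lt_le_trans (ln3_gt1 R) _.
  by rewrite ler_ln ?posrE ?ltr0n ?ler_nat //; lia.
have lnlnn : 0 < ln (ln (n%:R : R)) by apply: ln_gt0.
have lnlnlt : ln (ln (n%:R : R)) <= ln n%:R.
  by apply/ltW/ln_sublinear; lra.
have n0 : 0 <= n%:R :> R by rewrite ler0n.
(* As [ln (ln n) <= ln n], a bound of order [n * ln n] suffices. *)
apply: (@le_trans _ _ (2 ^+ K / ln 2 * (n%:R * ln n%:R))); last first.
  apply: ler_wpM2l; first by rewrite divr_ge0 ?exprn_ge0 // ltW.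
  rewrite -mulrA; apply: ler_wpM2l => //.
  by rewrite ler_pdivlMr // expr2; apply: ler_wpM2l => //; lra.
(* Shorter progressions are absorbed by the constant; [25 = 12 + 13] makes the [L] chosen below at
   least [12]. *)
have [small|large] := ltnP (size s) (2 ^ K).
  have ln2le : ln (2 : R) <= 1.
    by have := @le_ln1Dx R 1; apply; lra.
  apply: (@le_trans _ _ (2 ^+ K)).
    by rewrite -natrX ler_nat ltnW.
  have n1 : 1 <= n%:R * ln (n%:R : R).
    by rewrite mulr_ege1 ?ler1n ?ltW //; lia.
  have i1 : 1 <= (ln (2 : R))^-1 by rewrite invf_ge1.
  by rewrite -mulrA ler_peMr ?exprn_ge0 // mulr_ege1.
(* With this choice [2 ^ (L + 13) <= size s < 2 ^ (L + 14)]. *)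
pose L := (trunc_log 2 (size s) - 13)%N.
have size0 : (0 < size s)%N by apply: leq_trans large; rewrite expn_gt0.
have t25 : (25 <= trunc_log 2 (size s))%N by rewrite -KE trunc_log_max.
have LE : (L + 13 = trunc_log 2 (size s))%N by rewrite subnK //; lia.
apply: (@le_trans _ _ (2 ^+ 14 / ln 2 * (n%:R * ln n%:R))); last first.
  apply: ler_wpM2r; first by rewrite mulr_ge0 // ltW // (lt_trans ltr01).
  apply: ler_wpM2r; first by rewrite invr_ge0 ltW.
  by rewrite KE ler_eXn2l // ltr1n.
apply: (@ap_length_le_nlogn R _ n L) => //; first by lia.
  by rewrite [(L + 14)%N]addnS LE ltnW // trunc_log_ltn.
rewrite -cardB.
have [a [d [d0 adP]]] := arith_progression_nat sap.
apply: (@pow2_le_card_ap_factors _ a d); rewrite ?fset_uniq //; first by lia.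
move=> i iL; have is_ : (i < size s)%N.
  by apply: leq_trans iL _; rewrite LE trunc_logP.
have /imfset2P[b bB [c cB bcE]] := sB _ (adP i is_).
by exists (b, c).
Qed.
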